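(* For every $\rho^\star>0$ there is a constant $C>0$ depending only on $\rho^\star$ such that, for every positive integer $N$ (with $\epsilon=1/N$) and all $(i',j')\in\mathscr{F}_N$, $$\lambda_{\min}\big(B_D[i',j']\big)\ge C\big((i')^2+(j')^2\big).$$
   Context: Let $N$ be a positive integer, $\epsilon=1/N$, and $\mathscr{F}_N=\{(i',j')\in\mathbb{Z}^2:-N/2\le i',j'<N/2\}$. The imaginary unit is $\mathrm{i}$. Vectors: $\boldsymbol{l}_1=[1/2,-\sqrt3/2]^\top$, $\boldsymbol{l}_2=[1,0]^\top$, $\boldsymbol{l}_3=[1/2,\sqrt3/2]^\top$; $\boldsymbol{l}^\perp$ is $\boldsymbol{l}$ rotated counterclockwise by $\pi/2$; $\boldsymbol{a}\otimes\boldsymbol{b}=\boldsymbol{a}\boldsymbol{b}^\top$ (no conjugation). $\rho^\star>0$ is a fixed parameter independent of $\epsilon$. With $k_1=i'$, $k_2=i'+j'$, $k_3=j'$, define $$A_D[i',j']=\sum_{t=1}^3 4(\rho^\star\boldsymbol{l}_t\otimes\boldsymbol{l}_t+12\,\boldsymbol{l}_t^\perp\otimes\boldsymbol{l}_t^\perp)\frac{\sin^2(\pi k_t\epsilon)}{\epsilon^2},\quad \boldsymbol{b}_D[i',j']=\sum_{t=1}^3 12\,\mathrm{i}\,\boldsymbol{l}_t^\perp\frac{\sin(2\pi k_t\epsilon)}{\epsilon},\quad c_D[i',j']=\sum_{t=1}^3\big(12-8\sin^2(\pi k_t\epsilon)\big),$$ and the real symmetric $2\times2$ matrix (a Schur complement)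 $B_D=A_D+\boldsymbol{b}_D\otimes\boldsymbol{b}_D/c_D$. $\lambda_{\min}$ denotes the smallest eigenvalue. *)

(* Defs.v *)
From mathcomp Require Import all_boot all_order all_algebra.
From mathcomp Require Import reals trigo.
From mathcomp Require Export complex.

Set Implicit Arguments.
Unset Strict Implicit.
Unset Printing Implicit Defensive.

Import Order.TTheory GRing.Theory Num.Theory.

Local Open Scope ring_scope.
Local Open Scope complex_scope.

Definition inF (N : nat) (i j : int) : Prop :=
  (- (N%:Q / 2) <= i%:Q < N%:Q / 2) /\ (- (N%:Q / 2) <= j%:Q < N%:Q / 2).

Definition vec2 (K : Type) (x y : K) : 'cV[K]_2 :=
  \col_(r < 2) if r == ord0 then x else y.

Definition perp (K : zmodType) (v : 'cV[K]_2) : 'cV[K]_2 :=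
  vec2 (- v ord_max ord0) (v ord0 ord0).

(* No conjugation, also over the complex numbers. *)
Definition outer (K : pzRingType) (a b : 'cV[K]_2) : 'M[K]_2 := a *m b^T.

(* [t : 'I_3] runs over 0, 1, 2, standing for the indices 1, 2, 3. *)
Definition lvec (R : realType) (t : 'I_3) : 'cV[R]_2 :=
  nth 0 [:: vec2 (1 / 2) (- (Num.sqrt 3 / 2));
            vec2 1 0;
            vec2 (1 / 2) (Num.sqrt 3 / 2)] t.

Definition kidx (i j : int) (t : 'I_3) : int := nth 0 [:: i; i + j; j] t.

Section Symbol.
Variables (R : realType) (rho : R) (N : nat) (i j : int).

Local Notation eps := (N%:R^-1 : R).
Local Notation k t := ((kidx i j t)%:~R : R).
Local Notation l t := (lvec R t).

Definition A_D : 'M[R]_2 :=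
  \sum_(t < 3)
    (sin (pi * k t * eps) ^+ 2 / eps ^+ 2) *:
      (4 *: (rho *: outer (l t) (l t) + 12 *: outer (perp (l t)) (perp (l t)))).

Definition b_D : 'cV[R[i]]_2 :=
  \sum_(t < 3)
    (12 * 'i * (sin (2 * pi * k t * eps) / eps)%:C) *:
      map_mx (real_complex R) (perp (l t)).

Definition c_D : R := \sum_(t < 3) (12 - 8 * sin (pi * k t * eps) ^+ 2).

Definition B_D : 'M[R[i]]_2 :=
  map_mx (real_complex R) A_D + (c_D%:C)^-1 *: outer b_D b_D.

End Symbol.

(* The order on [R[i]] is partial: [x <= y] requires equal imaginary parts, so
   this says that every eigenvalue of [M] is real and at least [m]. *)
Definition is_lambda_min (R : realType) (n : nat) (M : 'M[R[i]]_n) (m : R) :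
    Prop :=
  eigenvalue M m%:C /\ forall z : R[i], eigenvalue M z -> m%:C <= z.

(* Main.v *)
Require Import Defs.
From mathcomp Require Import all_boot all_order all_algebra.
From mathcomp Require Import reals trigo.
From mathcomp Require Import topology normedtype derive ring lra.

Import Order.TTheory GRing.Theory Num.Theory.
Import numFieldNormedType.Exports.

Local Open Scope ring_scope.

(** Write [theta_t = pi k_t / N] and [s_t = sin theta_t].  Since [b_D] is [i]
    times a real vector [b'], the matrix [B_D] is the real symmetric matrix
    [A_D - b' b'^T / c_D] ([B_D_real]), and a lower bound on its quadratic form
    is a lower bound on its spectrum ([lambda_min_sym2]).

    By the double angle formula, [b' . v] is
    [24 N \sum_t cos theta_t (s_t (perp l_t . v))].  Because
    [c_D = \sum_t (4 + 8 cos^2 theta_t) >= 12 \sum_t cos^2 theta_t],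
    Cauchy-Schwarz bounds the negative term [(b' . v)^2 / c_D] by
    [48 N^2 \sum_t s_t^2 (perp l_t . v)^2], which is exactly the contribution of
    the vectors [perp l_t] to [A_D].  What is left ([qform_B_real_ge]) is
    [4 rho N^2 \sum_t s_t^2 (l_t . v)^2].

    This sum vanishes only trivially: among the three [s_t], as among the three
    [l_t . v], no two can be small while the third is not, because
    [theta_2 = theta_1 + theta_3] and [l_2 = l_1 + l_3].  Quantitatively, in
    either triple of squares each one is at most twice the sum of the other two
    ([balanced]), so that at most one entry of each triple is much smaller than
    the total and some index is large in both; the sum of products is then
    comparable to the product of the sums ([balanced_dot]).  Finally
    [\sum_t (l_t . v)^2 = 3/2 |v|^2], and [s_1^2 + s_3^2] is comparable to
    [theta_1^2 + theta_3^2] because [theta_1] and [theta_3] lie in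
    [[-pi/2, pi/2]] ([sqr_sin_ge]). *)

Set Implicit Arguments.
Unset Strict Implicit.

(** * Quadratic forms of 2 x 2 matrices *)

Definition dot {R : pzRingType} (a v : 'cV[R]_2) : R := (a^T *m v) ord0 ord0.

Definition qform {R : pzRingType} (M : 'M[R]_2) (v : 'cV[R]_2) : R :=
  dot v (M *m v).

Section QuadraticForms.
Variable R : comPzRingType.
Implicit Types (M : 'M[R]_2) (a b v : 'cV[R]_2).

Lemma dotE a v :
  dot a v = a ord0 ord0 * v ord0 ord0 + a ord_max ord0 * v ord_max ord0.
Proof.
rewrite /dot mxE big_ord_recl big_ord1 !mxE.
by rewrite (_ : lift ord0 ord0 = ord_max) //; apply/val_inj.
Qed.

Lemma qform_outer a b v : qform (outer a b) v = dot a v * dot b v.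
Proof.
rewrite /qform /outer -mulmxA {1}/dot mulmxA mxE big_ord1.
by congr (_ * _); rewrite -/(dot v a) !dotE; ring.
Qed.

Lemma qformD M1 M2 v : qform (M1 + M2) v = qform M1 v + qform M2 v.
Proof. by rewrite /qform /dot mulmxDl mulmxDr mxE. Qed.

Lemma qformZ k M v : qform (k *: M) v = k * qform M v.
Proof. by rewrite /qform /dot -scalemxAl -scalemxAr mxE. Qed.

Lemma qform_sum (I : finType) (F : I -> 'M[R]_2) v :
  qform (\sum_i F i) v = \sum_i qform (F i) v.
Proof. by rewrite /qform /dot mulmx_suml mulmx_sumr summxE. Qed.

Lemma dot_sum (I : finType) (F : I -> 'cV[R]_2) v :
  dot (\sum_i F i) v = \sum_i dot (F i) v.
Proof.
rewrite dotE !summxE !mulr_suml -big_split.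
by apply: eq_bigr => i _; rewrite dotE.
Qed.

Lemma dotZ k a v : dot (k *: a) v = k * dot a v.
Proof. by rewrite !dotE !mxE; ring. Qed.

Lemma outerZ k a b : outer (k *: a) (k *: b) = k ^+ 2 *: outer a b.
Proof. by rewrite /outer linearZ /= -scalemxAl -scalemxAr scalerA. Qed.

Lemma outer_sym a : (outer a a)^T = outer a a.
Proof. by rewrite /outer trmx_mul trmxK. Qed.

End QuadraticForms.

(** * Smallest eigenvalue of a real symmetric 2 x 2 matrix *)

Section Spectrum.
Variable R : realType.

Lemma char_poly2 (M : 'M[R]_2) :
  char_poly M =
    'X^2 - (M ord0 ord0 + M ord_max ord_max)%:P * 'X
      + (M ord0 ord0 * M ord_max ord_max - M ord0 ord_max * M ord_max ord0)%:P.
Proof.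
rewrite /char_poly /char_poly_mx (expand_det_row _ ord0) !big_ord_recl big_ord0.
rewrite /cofactor !det_mx11 !mxE /= !mulr1n !mulr0n.
have -> : lift ord0 ord0 = ord_max :> 'I_2 by exact/val_inj.
rewrite (_ : lift ord_max _ = ord0); last by apply/val_inj.
by rewrite rmorphB /= !rmorphM rmorphD /=; ring.
Qed.

(** The discriminant [(p - r)^2 + 4 q^2] is a sum of squares, so both roots are
    real. *)
Lemma char_poly_sym2 (M : 'M[R]_2) : M^T = M ->
  exists a b, a <= b /\ char_poly M = ('X - a%:P) * ('X - b%:P).
Proof.
move=> /matrixP/(_ ord0 ord_max); rewrite mxE => symM.
rewrite char_poly2 symM.
set p := M ord0 ord0; set r := M ord_max ord_max; set q := M ord0 ord_max.
have s0 := sqrtr_ge0 ((p - r) ^+ 2 + 4 * q ^+ 2).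
have ss : Num.sqrt ((p - r) ^+ 2 + 4 * q ^+ 2) ^+ 2 = (p - r) ^+ 2 + 4 * q ^+ 2.
  by apply: sqr_sqrtr; rewrite addr_ge0 ?sqr_ge0 // mulr_ge0 ?sqr_ge0.
move: s0 ss; set s := Num.sqrt _ => s0 ss.
exists ((p + r - s) / 2), ((p + r + s) / 2); split; first by lra.
set a := (p + r - s) / 2; set b := (p + r + s) / 2.
have -> : p + r = a + b by rewrite /a /b; field.
have -> : p * r - q * q = a * b.
  have -> : a * b = ((p + r) ^+ 2 - s ^+ 2) / 4 by rewrite /a /b; field.
  by rewrite ss; field.
by clearbody a b; rewrite polyCD polyCM; ring.
Qed.

(** Evaluate the form at an eigenvector. *)
Lemma qform_le_eigenvalue (M : 'M[R]_2) (mu a : R) :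
  (forall v, mu * dot v v <= qform M v) -> eigenvalue M a -> mu <= a.
Proof.
move=> geM /eigenvalueP[u uM u0]; have := geM u^T.
have -> : qform M u^T = a * dot u^T u^T.
  by rewrite /qform /dot mulmxA trmxK uM -scalemxAl mxE.
have u2 : 0 < dot u^T u^T.
  rewrite lt_neqAle dotE -!expr2 addr_ge0 ?sqr_ge0 // andbT eq_sym.
  rewrite paddr_eq0 ?sqr_ge0 // !sqrf_eq0 !mxE; apply/negP => /andP[/eqP ? /eqP ?].
  move/eqP: u0; apply; apply/matrixP => i j; rewrite ord1 mxE.
  have [->|->] : j = ord0 \/ j = ord_max; last 2 first; [by []..|].
  by case: j => [[|[|//]] ?]; [left|right]; exact/val_inj.
by rewrite ler_pM2r.
Qed.

(** The characteristic polynomial already splits over the reals, hence the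
    complex matrix has no eigenvalues besides the two real ones, and the smaller
    of these is above any lower bound of the form. *)
Lemma lambda_min_sym2 (M : 'M[R]_2) (mu : R) : M^T = M ->
  (forall v, mu * dot v v <= qform M v) ->
  exists2 m, is_lambda_min (map_mx (real_complex R) M) m & mu <= m.
Proof.
move=> symM geM; have [a [b [leab Mab]]] := char_poly_sym2 symM.
have eigM : eigenvalue M a.
  by rewrite eigenvalue_root_char Mab rootM !root_XsubC eqxx.
exists a; last exact: qform_le_eigenvalue geM eigM.
split; first by rewrite eigenvalue_map.
move=> z; rewrite eigenvalue_root_char -map_char_poly Mab rmorphM /= !map_polyXsubC.
by rewrite rootM !root_XsubC => /orP[]/eqP->; rewrite lecR.
Qed.

End Spectrum.

(** * Scalar estimates *)

Section Estimates.
Variable R : realType.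
Implicit Types x y z : R.

(** Halving the angle avoids concavity: with [y = x / 2], the mean value theorem
    gives [sin y >= y cos y], so [sin x = 2 sin y cos y >= y (2 cos^2 y)
    = y (1 + cos x) >= y]. *)
Lemma sin_ge_half x : 0 <= x <= pi / 2 -> x / 2 <= sin x.
Proof.
move=> /andP[x0 xpi]; have pi0 := pi_gt0 R.
have cosx : 0 <= cos x by apply: cos_ge0_pihalf; lra.
have y0 : 0 <= x / 2 by lra.
have [|c] := @MVT_segment R sin cos _ _ y0 (fun t _ => is_derive_sin t).
  exact/continuous_subspaceT/continuous_sin.
rewrite sin0 !subr0 in_itv /= => /andP[c0 cx] siny.
have cosc : cos (x / 2) <= cos c.
  move: cx; rewrite le_eqVlt => /predU1P[-> //|cx].
  by rewrite ltW // ltr_cos // in_itv /=; lra.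
have cosy : 0 <= cos (x / 2) by apply: cos_ge0_pihalf; lra.
have xE : x = (x / 2) *+ 2 by rewrite -mulr_natr; field.
have cos2 : cos x = cos (x / 2) ^+ 2 *+ 2 - 1 by rewrite {1}xE cos_mulr2n.
have sinx : sin x = cos (x / 2) * (cos c * (x / 2)) *+ 2.
  by rewrite {1}xE sin_mulr2n siny.
have : cos (x / 2) * cos (x / 2) <= cos (x / 2) * cos c by rewrite ler_wpM2l.
rewrite -expr2 => cosyc.
have : (x / 2) * 1 <= (x / 2) * (2 * (cos (x / 2) * cos c)).
  by rewrite ler_wpM2l //; lra.
by rewrite sinx; lra.
Qed.

Lemma sqr_sin_ge x : `|x| <= pi / 2 -> x ^+ 2 / 4 <= sin x ^+ 2.
Proof.
move=> xpi; have : `|x| / 2 <= sin `|x| by apply: sin_ge_half; rewrite normr_ge0.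
have -> : sin x ^+ 2 = sin `|x| ^+ 2.
  by case: (ger0P x) => // _; rewrite sinN sqrrN.
by rewrite -(real_normK (num_real x)); have := normr_ge0 x; nra.
Qed.

Lemma sqr_add_le x y : (x + y) ^+ 2 <= 2 * (x ^+ 2 + y ^+ 2).
Proof. by have := sqr_ge0 (x - y); lra. Qed.

Lemma sqr_sinD_le x y : sin (x + y) ^+ 2 <= 2 * (sin x ^+ 2 + sin y ^+ 2).
Proof.
rewrite sinD; apply: le_trans (sqr_add_le _ _) _.
rewrite !exprMn ler_wpM2l // lerD //.
  by rewrite ler_piMr ?sqr_ge0 // cos2sin2; have := sqr_ge0 (sin y); lra.
by rewrite ler_piMl ?sqr_ge0 // cos2sin2; have := sqr_ge0 (sin x); lra.
Qed.

Definition balanced (x y z : R) : Prop :=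
  [/\ 0 <= x, 0 <= y & 0 <= z] /\
  [/\ x <= 2 * (y + z), y <= 2 * (z + x) & z <= 2 * (x + y)].

Lemma balanced_rot x y z : balanced x y z -> balanced y z x.
Proof. by move=> [[? ? ?] [? ? ?]]; split. Qed.

(** When [q1] is the smallest entry of the balanced triple [q], the other two are
    each at least a sixth of its total; since [a1 <= 2 (a2 + a3)], the entries
    [a2] and [a3] carry at least a third of the total of [a]. *)
Lemma balanced_dot_min (a1 a2 a3 q1 q2 q3 : R) :
  balanced a1 a2 a3 -> balanced q1 q2 q3 -> q1 <= q2 -> q1 <= q3 ->
  (a1 + a2 + a3) * (q1 + q2 + q3) / 18 <= a1 * q1 + a2 * q2 + a3 * q3.
Proof.
move=> [[? ? ?] [? ? ?]] [[? ? ?] [? ? ?]] ? ?.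
set E := q1 + q2 + q3.
have E2 : E / 6 <= q2 by rewrite /E; lra.
have E3 : E / 6 <= q3 by rewrite /E; lra.
have E0 : 0 <= E by rewrite /E; lra.
have : a2 * (E / 6) <= a2 * q2 by rewrite ler_wpM2l.
have : a3 * (E / 6) <= a3 * q3 by rewrite ler_wpM2l.
have : 0 <= a1 * q1 by rewrite mulr_ge0.
have : a1 * E <= 2 * (a2 + a3) * E by rewrite ler_wpM2r.
lra.
Qed.

(** Both hypotheses and conclusion are invariant under cyclic shifts, so any
    entry of [q] may be taken to be the smallest. *)
Lemma balanced_dot (a1 a2 a3 q1 q2 q3 : R) :
  balanced a1 a2 a3 -> balanced q1 q2 q3 ->
  (a1 + a2 + a3) * (q1 + q2 + q3) / 18 <= a1 * q1 + a2 * q2 + a3 * q3.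
Proof.
move=> ba bq; have [ba' bq'] := (balanced_rot ba, balanced_rot bq).
have [ba2 bq2] := (balanced_rot ba', balanced_rot bq').
case: (leP q1 q2) => q12; case: (leP q1 q3) => q13; case: (leP q2 q3) => q23.
all: try by apply: balanced_dot_min.
all: try by have := balanced_dot_min ba' bq'; lra.
all: try by have := balanced_dot_min ba2 bq2; lra.
Qed.

Lemma balanced_sqr x z : balanced (x ^+ 2) ((x + z) ^+ 2) (z ^+ 2).
Proof.
have := sqr_add_le x z.
have := sqr_add_le (x + z) (- z); rewrite addrK sqrrN.
have := sqr_add_le (x + z) (- x); rewrite addrAC addrN add0r sqrrN => *.
by split; split; rewrite ?sqr_ge0 //; lra.
Qed.

Lemma balanced_sqr_sin x z :
  balanced (sin x ^+ 2) (sin (x + z) ^+ 2) (sin z ^+ 2).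
Proof.
have := sqr_sinD_le x z.
have := sqr_sinD_le (x + z) (- z); rewrite addrK sinN sqrrN.
have := sqr_sinD_le (x + z) (- x); rewrite addrAC addrN add0r sinN sqrrN => *.
by split; split; rewrite ?sqr_ge0 //; lra.
Qed.

(** Lagrange's identity. *)
Lemma cauchy_schwarz3 (a1 a2 a3 b1 b2 b3 : R) :
  (a1 * b1 + a2 * b2 + a3 * b3) ^+ 2 <=
  (a1 ^+ 2 + a2 ^+ 2 + a3 ^+ 2) * (b1 ^+ 2 + b2 ^+ 2 + b3 ^+ 2).
Proof.
have := sqr_ge0 (a1 * b2 - a2 * b1); have := sqr_ge0 (a1 * b3 - a3 * b1).
by have := sqr_ge0 (a2 * b3 - a3 * b2); lra.
Qed.

End Estimates.

(** * The form carried by the vectors [l_t] *)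

Section Frame.
Variable R : realType.
Implicit Type v : 'cV[R]_2.

Lemma dot_lvecD v : dot (lvec R 0) v + dot (lvec R 2) v = dot (lvec R 1) v.
Proof. by rewrite !dotE /lvec /= !mxE /=; field. Qed.

Lemma sum_sqr_dot_lvec v :
  dot (lvec R 0) v ^+ 2 + dot (lvec R 1) v ^+ 2 + dot (lvec R 2) v ^+ 2 =
  3 / 2 * dot v v.
Proof.
have s3 : Num.sqrt 3 ^+ 2 = 3 :> R by rewrite sqr_sqrtr.
rewrite !dotE /lvec /= !mxE /=.
transitivity (3 / 2 * v ord0 ord0 ^+ 2 +
  Num.sqrt 3 ^+ 2 / 2 * v ord_max ord0 ^+ 2); first by field.
by rewrite s3; ring.
Qed.

(** The constant is [1/4] (from the bound on the sine) times [3/2] (from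
    [sum_sqr_dot_lvec]) times [1/18] (from [balanced_dot]). *)
Lemma frame_form_ge x z v : `|x| <= pi / 2 -> `|z| <= pi / 2 ->
  (x ^+ 2 + z ^+ 2) / 48 * dot v v <=
    sin x ^+ 2 * dot (lvec R 0) v ^+ 2 +
    sin (x + z) ^+ 2 * dot (lvec R 1) v ^+ 2 +
    sin z ^+ 2 * dot (lvec R 2) v ^+ 2.
Proof.
move=> /sqr_sin_ge sx /sqr_sin_ge sz.
have := balanced_dot (balanced_sqr_sin x z)
  (balanced_sqr (dot (lvec R 0) v) (dot (lvec R 2) v)).
rewrite dot_lvecD sum_sqr_dot_lvec; apply: le_trans.
have v0 : 0 <= dot v v by rewrite dotE -!expr2 addr_ge0 ?sqr_ge0.
have := sqr_ge0 (sin (x + z)) => sy.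
have : (x ^+ 2 + z ^+ 2) / 4 * dot v v <=
    (sin x ^+ 2 + sin (x + z) ^+ 2 + sin z ^+ 2) * dot v v.
  by rewrite ler_wpM2r //; lra.
lra.
Qed.

End Frame.

(** * Reduction to a real form *)

Section RealForm.
Variables (R : realType) (rho : R) (N : nat) (i j : int).

Local Notation eps := (N%:R^-1 : R).
Local Notation k t := ((kidx i j t)%:~R : R).
Local Notation l t := (lvec R t).
Local Notation theta t := (pi * k t * eps).

Definition b_real : 'cV[R]_2 :=
  \sum_(t < 3) (12 * (sin (2 * pi * k t * eps) / eps)) *: perp (l t).

Definition B_real : 'M[R]_2 :=
  A_D rho N i j - (c_D R N i j)^-1 *: outer b_real b_real.

Lemma b_D_real : b_D R N i j = 'i%C *: map_mx (real_complex R) b_real.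
Proof.
rewrite /b_D /b_real map_mx_sum scaler_sumr; apply: eq_bigr => t _.
rewrite map_mxZ scalerA; congr (_ *: _).
by rewrite [in RHS]rmorphM rmorph_nat mulrCA mulrA.
Qed.

Lemma B_D_real : B_D rho N i j = map_mx (real_complex R) B_real.
Proof.
rewrite /B_D /B_real map_mxB map_mxZ; congr (_ + _).
rewrite b_D_real outerZ sqr_i scaleN1r scalerN fmorphV.
by rewrite /outer map_mxM map_trmx.
Qed.

Lemma B_real_sym : B_real^T = B_real.
Proof.
have trZ a (M : 'M[R]_2) : (a *: M)^T = a *: M^T by rewrite linearZ.
rewrite /B_real /A_D linearB /= trZ outer_sym linear_sum.
congr (_ - _); apply: eq_bigr => t _.
by rewrite /= !trZ linearD /= !trZ !outer_sym.
Qed.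

(** Termwise, [12 cos^2 <= 4 + 8 cos^2 = 12 - 8 sin^2]. *)
Lemma c_D_ge : 12 * \sum_(t < 3) cos (theta t) ^+ 2 <= c_D R N i j.
Proof.
rewrite mulr_sumr; apply: ler_sum => t _; rewrite cos2sin2.
by have := sqr_ge0 (sin (theta t)); lra.
Qed.

Lemma c_D_gt0 : 0 < c_D R N i j.
Proof.
have c t : 4 <= 12 - 8 * sin (theta t) ^+ 2.
  by have := sqr_ge0 (cos (theta t)); rewrite cos2sin2; lra.
rewrite /c_D; apply: lt_le_trans (ler_sum _ (fun t _ => c t)).
by rewrite sumr_const card_ord pmulrn_lgt0 ?ltr0n.
Qed.

Lemma dot_b_real v :
  dot b_real v =
    24 * \sum_(t < 3) cos (theta t) * (sin (theta t) / eps * dot (perp (l t)) v).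
Proof.
rewrite dot_sum mulr_sumr; apply: eq_bigr => t _; rewrite dotZ.
have -> : 2 * pi * k t * eps = theta t *+ 2 by rewrite -mulr_natr; ring.
by rewrite sin_mulr2n -mulr_natr; ring.
Qed.

Lemma qform_A_D v :
  qform (A_D rho N i j) v =
    4 * rho * N%:R ^+ 2 * (\sum_(t < 3) sin (theta t) ^+ 2 * dot (l t) v ^+ 2)
      + 48 * \sum_(t < 3) (sin (theta t) / eps * dot (perp (l t)) v) ^+ 2.
Proof.
rewrite qform_sum !mulr_sumr -big_split; apply: eq_bigr => t _ /=.
by rewrite !qformZ qformD !qformZ !qform_outer -exprVn invrK; ring.
Qed.

(** The [perp l_t] part of [A_D] absorbs the Schur complement term, by
    Cauchy-Schwarz and [c_D_ge]: [24^2 = 12 * 48]. *)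
Lemma qform_B_real_ge v :
  4 * rho * N%:R ^+ 2 * (\sum_(t < 3) sin (theta t) ^+ 2 * dot (l t) v ^+ 2)
    <= qform B_real v.
Proof.
rewrite qformD -scaleNr qformZ qform_outer qform_A_D -addrA lerDl mulNr subr_ge0.
rewrite ler_pdivrMl ?c_D_gt0 // -expr2 dot_b_real.
set y := fun t => sin (theta t) / eps * dot (perp (l t)) v.
have cs : (\sum_(t < 3) cos (theta t) * y t) ^+ 2 <=
    (\sum_(t < 3) cos (theta t) ^+ 2) * \sum_(t < 3) y t ^+ 2.
  rewrite !big_ord_recl !big_ord0 !addr0 !addrA; exact: cauchy_schwarz3.
have y0 : 0 <= \sum_(t < 3) y t ^+ 2 by apply: sumr_ge0 => t _; exact: sqr_ge0.
have := ler_wpM2r y0 c_D_ge.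
rewrite exprMn; move: cs; rewrite /y; lra.
Qed.

End RealForm.

(** * The lower bound *)

Lemma inF_theta (R : realType) (N : nat) (i j : int) : (0 < N)%N ->
  inF N i j -> `|pi * i%:~R * N%:R^-1 : R| <= pi / 2 /\
               `|pi * j%:~R * N%:R^-1 : R| <= pi / 2.
Proof.
have half (n : int) : (0 < N)%N -> - (N%:Q / 2) <= n%:Q < N%:Q / 2 ->
    `|pi * n%:~R * N%:R^-1 : R| <= pi / 2.
  move=> N0 /andP[n1 n2]; have n0 : 0 < N%:R :> R by rewrite ltr0n.
  have {n1} : (- N%:Z)%:Q <= (2 * n)%:Q by rewrite rmorphN rmorphM /=; lra.
  have {n2} : (2 * n)%:Q <= N%:Z%:Q by rewrite rmorphM /=; lra.
  rewrite !ler_int -(ler_int R) -[in X in _ -> X -> _](ler_int R).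
  rewrite rmorphN rmorphM /= => n2 n1.
  have nN : `|n%:~R : R| <= N%:R / 2 by rewrite ler_norml; lra.
  rewrite !normrM normfV (ger0_norm (pi_ge0 R)) (gtr0_norm n0) ler_pdivrMr //.
  have := ler_wpM2l (pi_ge0 R) nN; lra.
by move=> N0 [/(half _ N0) ? /(half _ N0) ?].
Qed.

Unset Implicit Arguments.
Set Strict Implicit.

Theorem proposition4p4 (R : realType) (rho : R) (rho_gt0 : 0 < rho) :
  exists2 C : R, 0 < C &
    forall (N : nat) (i j : int), (0 < N)%N -> inF N i j ->
      exists2 m : R, is_lambda_min (B_D rho N i j) m &
        C * (i%:~R ^+ 2 + j%:~R ^+ 2) <= m.
Proof.
exists (rho * pi ^+ 2 / 12); first by rewrite divr_gt0 ?mulr_gt0 ?exprn_gt0 ?pi_gt0.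
move=> N i j N0 /(inF_theta R N0)[x_le z_le].
rewrite B_D_real; apply: lambda_min_sym2 => [|v]; first exact: B_real_sym.
apply: le_trans (qform_B_real_ge _ _ _ _ _).
have n0 : N%:R != 0 :> R by rewrite pnatr_eq0 -lt0n.
have n2 : 0 <= 4 * rho * N%:R ^+ 2.
  by rewrite !mulr_ge0 ?exprn_ge0 ?ler0n // ltW.
rewrite !big_ord_recl big_ord0 addr0 addrA.
have -> : lift ord0 ord0 = 1 :> 'I_3 by exact/val_inj.
have -> : lift ord0 (lift ord0 ord0) = 2 :> 'I_3 by exact/val_inj.
have theta2 : pi * (i + j)%:~R * N%:R^-1 =
    pi * i%:~R * N%:R^-1 + pi * j%:~R * N%:R^-1 :> R.
  by rewrite rmorphD /= mulrDr mulrDl.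
rewrite /kidx /= theta2; apply: le_trans (ler_wpM2l n2 (frame_form_ge v x_le z_le)).
by rewrite le_eqVlt; apply/predU1P; left; field.
Qed.
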